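(* Assume that $\Psi(X,U)$ and $H(X^+)$ have full row rank. Then the control forward-backward consistency matrix $M_{CC}$ has the following properties: (a) $M_{CC}$ is similar to a (real) symmetric matrix; (b) the eigenvalues of $M_{CC}$ belong to the interval $[0,1]$.
   Context: System: $x^+=\mathcal T(x,u)$ with $\mathcal T:\mathcal X\times\mathcal U\to\mathcal X$, $\mathcal X\subseteq\mathbb R^n$, $\mathcal U\subseteq\mathbb R^m$. Normal basis: $H:\mathcal X\to\mathbb R^{n_{\mathcal H}}$ and a matrix-valued function $G:\mathcal U\to\mathbb R^{(n_\Psi-n_{\mathcal H})\times n_{\mathcal H}}$ are given, and $\Psi:\mathcal X\times\mathcal U\to\mathbb R^{n_\Psi}$ is $\Psi(x,u)=\begin{bmatrix}I\\ G(u)\end{bmatrix}H(x)$, with $I$ the $n_{\mathcal H}\times n_{\mathcal H}$ identity; the components of $\Psi$ are linearly independent functions. Data: $X,X^+\in\mathbb R^{n\times N}$, $U\in\mathbb R^{m\times N}$ with columns $x_i\in\mathcal X$, $x_i^+$, $u_i\in\mathcal U$ satisfying $x_i^+=\mathcal T(x_i,u_i)$, $i=1,\dots,N$. Write $\Psi(X,U)=[\Psi(x_1,u_1),\dots,\Psi(x_N,u_N)]\in\mathbb R^{n_\Psi\times N}$, $H(X^+)=[H(x_1^+),\dots,H(x_N^+)]\in\mathbb R^{n_{\mathcal H}\times N}$. $^\dagger$ is the Moore–Penrose pseudoinverse. Control consistency matrix: with $A_f=H(X^+)\Psi(X,U)^\dagger$ (minimizer of $\|H(X^+)-P\Psi(X,U)\|_F$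 over $P$) and $A_b=\Psi(X,U)H(X^+)^\dagger$ (minimizer of $\|\Psi(X,U)-QH(X^+)\|_F$ over $Q$), set $M_{CC}=I-A_fA_b\in\mathbb R^{n_{\mathcal H}\times n_{\mathcal H}}$. *)

(* Defs.v *)
From mathcomp Require Import all_boot all_order all_algebra.
From mathcomp Require Import classical_sets reals.
From mathcomp Require Import complex.

Set Implicit Arguments.
Unset Strict Implicit.
Unset Printing Implicit Defensive.

Import GRing.Theory Num.Theory.
Local Open Scope ring_scope.

(* The four Penrose conditions.  They characterize the Moore-Penrose          *)
(* pseudoinverse, which differs from mathcomp's pinvmx: the latter does not   *)
(* require A *m B and B *m A to be symmetric.                                 *)
Definition penrose (R : realFieldType) (m n : nat) (A : 'M[R]_(m, n))
    (B : 'M[R]_(n, m)) : bool :=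
  [&& A *m B *m A == A, B *m A *m B == B,
      (A *m B)^T == A *m B & (B *m A)^T == B *m A].

Lemma mulmx_tr_eq0 (R : realFieldType) (n : nat) (v : 'rV[R]_n) :
  v *m v^T = 0 -> v = 0.
Proof.
move=> /matrixP/(_ 0 0); rewrite !mxE => v0; apply/rowP => j; rewrite mxE.
have sq_ge0 i : true -> 0 <= v 0 i * v^T i 0 by rewrite mxE -expr2 sqr_ge0.
have /eqP := psumr_eq0P sq_ge0 v0 (i := j) isT.
by rewrite mxE -expr2 sqrf_eq0 => /eqP.
Qed.

Lemma row_free_gram (R : realFieldType) (m n : nat) (F : 'M[R]_(m, n)) :
  row_free F -> F *m F^T \in unitmx.
Proof.
move=> Ffree; rewrite -row_free_unit -kermx_eq0; apply/eqP/row_matrixP => i.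
rewrite row0; set v := row i _.
have vF0 : v *m (F *m F^T) = 0 by apply/sub_kermxP; exact: row_sub.
apply: (row_free_inj Ffree); rewrite mul0mx; apply: mulmx_tr_eq0.
by rewrite trmx_mul mulmxA -(mulmxA v) vF0 mul0mx.
Qed.

Lemma penrose_exists (R : realFieldType) (m n : nat) (A : 'M[R]_(m, n)) :
  exists B, penrose A B.
Proof.
have [r [C [F [-> uC uF]]]] : exists r (C : 'M[R]_(m, r)) (F : 'M[R]_(r, n)),
    [/\ A = C *m F, C^T *m C \in unitmx & F *m F^T \in unitmx].
  exists (\rank A), (col_base A), (row_base A); split.
  - by rewrite mulmx_base.
  - rewrite -{2}[col_base A]trmxK row_free_gram // /row_free mxrank_tr.
    exact: col_base_full.
  - exact/row_free_gram/row_base_free.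
have trV k (B : 'M[R]_k) : B^T = B -> (invmx B)^T = invmx B.
  by rewrite trmx_inv => ->.
have [F' [FF' F'F]] : exists F', F *m F' = 1%:M /\ (F' *m F)^T = F' *m F.
  exists (F^T *m invmx (F *m F^T)); split; first by rewrite mulmxA mulmxV.
  by rewrite !trmx_mul trV ?trmxK ?mulmxA // trmx_mul trmxK.
have [C' [C'C CC']] : exists C', C' *m C = 1%:M /\ (C *m C')^T = C *m C'.
  exists (invmx (C^T *m C) *m C^T); split; first by rewrite -mulmxA mulVmx.
  by rewrite !trmx_mul trV ?trmxK ?mulmxA // trmx_mul trmxK.
have AB : C *m F *m (F' *m C') = C *m C'.
  by rewrite mulmxA -(mulmxA C) FF' mulmx1.
have BA : F' *m C' *m (C *m F) = F' *m F.
  by rewrite mulmxA -(mulmxA F') C'C mulmx1.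
exists (F' *m C'); rewrite /penrose AB BA CC' F'F !eqxx !andbT.
by rewrite mulmxA -(mulmxA C) C'C mulmx1 eqxx mulmxA -(mulmxA F') FF' mulmx1 /=.
Qed.

Lemma penrose_unique (R : realFieldType) (m n : nat) (A : 'M[R]_(m, n))
    (B C : 'M[R]_(n, m)) : penrose A B -> penrose A C -> B = C.
Proof.
move=> /and4P[/eqP ABA /eqP BAB /eqP AB /eqP BA].
move=> /and4P[/eqP ACA /eqP CAC /eqP AC /eqP CA].
have eAB : A *m B = A *m C.
  by rewrite -AB -{1}ACA -(mulmxA (A *m C)) trmx_mul AB AC mulmxA ABA.
have eBA : B *m A = C *m A.
  by rewrite -BA -{1}ACA -mulmxA mulmxA trmx_mul BA CA -mulmxA (mulmxA A) ABA.
by rewrite -BAB eBA -mulmxA eAB mulmxA CAC.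
Qed.

Definition mp_pinv (R : realFieldType) (m n : nat) (A : 'M[R]_(m, n)) :
  'M[R]_(n, m) := xchoose (penrose_exists A).

Lemma mp_pinvP (R : realFieldType) (m n : nat) (A : 'M[R]_(m, n)) :
  penrose A (mp_pinv A).
Proof. exact: xchooseP. Qed.

(* The matrix [f(a_1), ..., f(a_N)], where a_j is the j-th column of A.       *)
Definition map_cols (R : realType) (n p N : nat) (f : 'cV[R]_n -> 'cV[R]_p)
  (A : 'M[R]_(n, N)) : 'M[R]_(p, N) := \matrix_(i, j) f (col j A) i 0.

Definition map_cols2 (R : realType) (n m p N : nat)
    (f : 'cV[R]_n -> 'cV[R]_m -> 'cV[R]_p)
    (A : 'M[R]_(n, N)) (B : 'M[R]_(m, N)) : 'M[R]_(p, N) :=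
  \matrix_(i, j) f (col j A) (col j B) i 0.

(* The dimension of the codomain is written nH + k, so that G u has           *)
(* k = (nH + k) - nH rows.                                                    *)
Definition normal_basis (R : realType) (n m nH k : nat)
    (H : 'cV[R]_n -> 'cV[R]_nH) (G : 'cV[R]_m -> 'M[R]_(k, nH))
    (x : 'cV[R]_n) (u : 'cV[R]_m) : 'cV[R]_(nH + k) :=
  col_mx 1%:M (G u) *m H x.

(* The components of F are linearly independent functions on Xs * Us; the     *)
(* values of F outside Xs * Us are irrelevant.                                *)
Definition components_independent (R : realType) (n m p : nat)
    (Xs : set 'cV[R]_n) (Us : set 'cV[R]_m)
    (F : 'cV[R]_n -> 'cV[R]_m -> 'cV[R]_p) : Prop :=
  forall c : 'I_p -> R,
    (forall x u, Xs x -> Us u -> \sum_(i < p) c i * F x u i 0 = 0) ->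
    forall i, c i = 0.

(* In the three definitions below, PsiXU and HXp stand for the data matrices  *)
(* Psi(X, U) and H(X^+).                                                      *)
Definition A_f (R : realType) (p q N : nat)
    (PsiXU : 'M[R]_(p, N)) (HXp : 'M[R]_(q, N)) : 'M[R]_(q, p) :=
  HXp *m mp_pinv PsiXU.

Definition A_b (R : realType) (p q N : nat)
    (PsiXU : 'M[R]_(p, N)) (HXp : 'M[R]_(q, N)) : 'M[R]_(p, q) :=
  PsiXU *m mp_pinv HXp.

Definition M_CC (R : realType) (p q N : nat)
    (PsiXU : 'M[R]_(p, N)) (HXp : 'M[R]_(q, N)) : 'M[R]_q :=
  1%:M - A_f PsiXU HXp *m A_b PsiXU HXp.

(* Main.v *)
(** Write [Y] for [H(X^+)].  As [Y] has full row rank, [Y^+ = Y^T (Y Y^T)^-1],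
    and with [Q] the orthogonal projection onto the kernel of [Psi(X, U)] one
    gets [M_CC = (Y Q Y^T) (Y Y^T)^-1], a generalized symmetric eigenproblem.
    If [P (Y Y^T) P^T = 1] with [P] invertible, conjugation by [P] turns [M_CC]
    into the symmetric matrix [(P Y) Q (P Y)^T].  An eigenvalue [z] of [M_CC]
    with left eigenvector [v] is the Rayleigh quotient of the orthogonal
    projection [Q] at [v Y], hence lies in [[0, 1]]. *)
Require Import Defs.
From mathcomp Require Import all_boot all_order all_algebra.
From mathcomp Require Import classical_sets reals.
From mathcomp Require Import complex.

Set Implicit Arguments.
Unset Strict Implicit.
Unset Printing Implicit Defensive.

Import Order.TTheory GRing.Theory Num.Theory.
Local Open Scope ring_scope.
Local Open Scope complex_scope.
Local Open Scope sesquilinear_scope.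

(** Block elimination, as in the Cholesky factorization: one step clears the first row and column,
    the Schur complement stays symmetric positive definite, and induction applies to it. Square
    roots of the pivots are why [R] is real closed. *)
Lemma posdef_congruent_1 (R : rcfType) (n : nat) (W : 'M[R]_n) :
  W^T = W -> (forall v : 'rV_n, v != 0 -> 0 < (v *m W *m v^T) 0 0) ->
  exists P : 'M[R]_n, P *m W *m P^T = 1%:M.
Proof.
elim: n W => [|n IHn]; first by move=> W _ _; exists 0; apply/matrixP => -[].
rewrite -[n.+1]/(1 + n)%N => W Wsym Wpos.
pose a := ulsubmx W; pose b := ursubmx W; pose D := drsubmx W.
have Dsym : D^T = D by rewrite trmx_drsub Wsym.
have defW : W = block_mx a b b^T D.
  rewrite -[LHS]submxK; congr block_mx.
  by rewrite trmx_ursub Wsym.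
have a_gt0 : 0 < a 0 0.
  have := Wpos (row_mx 1%:M 0 : 'rV_(1 + n)).
  rewrite defW mul_row_block !mul0mx !mul1mx !addr0 tr_row_mx mul_row_col.
  rewrite trmx1 trmx0 mulmx1 mulmx0 addr0; apply.
  rewrite row_mx_eq0 negb_and; apply/orP; left; apply/eqP => /matrixP/(_ 0 0).
  by rewrite !mxE /= => /eqP; rewrite oner_eq0.
pose s := Num.sqrt (a 0 0).
have s_neq0 : s != 0 by rewrite sqrtr_eq0 -ltNge.
have defa : a = (s ^+ 2)%:M by rewrite sqr_sqrtr ?ltW // -mx11_scalar.
(* Chosen so that [c *m a = - b^T], which makes the off-diagonal blocks of [L *m W *m L^T]
   vanish. *)
pose c := - s^-1 ^+ 2 *: b^T.
pose L : 'M_(1 + n) := block_mx s^-1%:M 0 c 1%:M.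
have ca : c *m a = - b^T.
  rewrite defa mul_mx_scalar scalerA mulrN -exprMn mulfV // expr1n.
  by rewrite scaleN1r.
(* The Schur complement of the pivot [a] in [W]. *)
pose D' := D + c *m b.
have LWL : L *m W *m L^T = block_mx 1%:M 0 0 D'.
  rewrite defW /L tr_block_mx !mulmx_block !mul0mx !mul1mx !addr0.
  rewrite ca addNr !mul0mx trmx0 trmx1 tr_scalar_mx !mulmx0 !mulmx1 !addr0 add0r.
  congr block_mx; last by rewrite addrC.
    by rewrite defa -!scalar_mxM expr2 mulrA mulVf // mul1r mulfV.
  have ac : a *m c^T = - b.
    by rewrite -[RHS]trmxK linearN /= -ca trmx_mul defa tr_scalar_mx.
  by rewrite -mulmxA ac mulmxN addNr.
have D'sym : D'^T = D'.
  rewrite /D' linearD /= Dsym trmx_mul /c linearZ /= trmxK.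
  by rewrite -scalemxAl -scalemxAr.
have [P' P'D'] : exists P' : 'M_n, P' *m D' *m P'^T = 1%:M.
  apply: IHn => // v v_neq0.
  (* The form of [D'] at [v] is that of [W] at this vector, whose right block is [v]. *)
  have w_neq0 : row_mx 0 v *m L != 0.
    rewrite mul_row_block !mul0mx mulmx1 !add0r row_mx_eq0 negb_and.
    by rewrite v_neq0 orbT.
  have -> : v *m D' *m v^T = row_mx 0 v *m (L *m W *m L^T) *m (row_mx 0 v)^T.
    rewrite LWL mul_row_block !mul0mx mulmx0 !add0r tr_row_mx mul_row_col.
    by rewrite mul0mx add0r.
  by have := Wpos _ w_neq0; rewrite trmx_mul !mulmxA.
pose B : 'M_(1 + n) := block_mx 1%:M 0 0 P'; exists (B *m L).
have -> : B *m L *m W *m (B *m L)^T = B *m (L *m W *m L^T) *m B^T.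
  by rewrite trmx_mul !mulmxA.
rewrite LWL.
rewrite tr_block_mx !mulmx_block !trmx0 trmx1 !mul0mx !mulmx0 !mulmx1 !addr0.
by rewrite !add0r mul0mx P'D' -scalar_mx_block.
Qed.

(** Gram-Schmidt in matrix form: the rows of [P *m Y] are orthonormal. The Gram matrix is positive
    definite, its form at [v] being the squared norm of [v *m Y]. *)
Lemma row_free_orthonormalize (R : rcfType) (m n : nat) (Y : 'M[R]_(m, n)) :
  row_free Y -> exists P : 'M[R]_m, P *m (Y *m Y^T) *m P^T = 1%:M.
Proof.
move=> Yfree; apply: posdef_congruent_1; first by rewrite trmx_mul trmxK.
move=> v v_neq0; rewrite mulmxA -mulmxA -trmx_mul.
rewrite lt_def; apply/andP; split; last first.
  by rewrite mxE sumr_ge0 // => i _; rewrite [_^T _ _]mxE -expr2 sqr_ge0.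
apply: contraNneq v_neq0 => vY0.
have vY : v *m Y = 0.
  by apply: mulmx_tr_eq0; rewrite [LHS]mx11_scalar vY0 raddf0.
by apply/eqP/(row_free_inj Yfree); rewrite vY mul0mx.
Qed.

Lemma penrose_row_free (R : realFieldType) (m n : nat) (Y : 'M[R]_(m, n)) :
  row_free Y -> mp_pinv Y = Y^T *m invmx (Y *m Y^T).
Proof.
move=> Yfree; apply: penrose_unique (mp_pinvP Y) _.
have Wunit := row_free_gram Yfree.
have Wsym : (invmx (Y *m Y^T))^T = invmx (Y *m Y^T).
  by rewrite trmx_inv trmx_mul trmxK.
rewrite /penrose mulmxA mulmxV // mul1mx trmx1 !eqxx /=.
by rewrite -!mulmxA (mulmxA Y) mulmxV // mulmx1 !trmx_mul trmxK Wsym -!mulmxA !eqxx.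
Qed.

(** Both [z] and [1 - z], times the squared norm of [u], are squared norms: those of [u *m Q] and
    [u *m (1%:M - Q)]. The vector [u] need not be an eigenvector of [Q]. In the partial order of [C]
    the conclusion also says that [z] is real. *)
Lemma rayleigh_projector (C : numClosedFieldType) (n : nat) (Q : 'M[C]_n)
    (u : 'rV[C]_n) (z : C) :
  Q ^t* = Q -> Q *m Q = Q -> u != 0 ->
  u *m Q *m u ^t* = z *: (u *m u ^t*) -> 0 <= z <= 1.
Proof.
move=> Qherm Qidem u_neq0 /matrixP/(_ 0 0).
have dotQ (v : 'rV_n) E : E ^t* = E -> E *m E = E ->
    (v *m E *m v ^t*) 0 0 = dotmx (v *m E) (v *m E).
  move=> Eherm Eidem.
  by rewrite dotmxE trmx_mul map_mxM /= Eherm mulmxA -(mulmxA v E E) Eidem.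
have u_gt0 : 0 < dotmx u u by rewrite dnorm_gt0.
have CQherm : (1%:M - Q) ^t* = 1%:M - Q.
  by rewrite linearB /= map_mxB /= Qherm trmx1 map_mx1.
have CQidem : (1%:M - Q) *m (1%:M - Q) = 1%:M - Q.
  by rewrite mulmxBl mul1mx mulmxBr mulmx1 Qidem subrr subr0.
rewrite [RHS]mxE -(dotmxE u u) => uQ.
have z_ge0 : 0 <= z * dotmx u u by rewrite -uQ dotQ // dnorm_ge0.
have z_le1 : 0 <= (1 - z) * dotmx u u.
  have -> : (1 - z) * dotmx u u = (u *m (1%:M - Q) *m u ^t*) 0 0.
    rewrite mulrBl mul1r -uQ dotmxE mulmxBr mulmx1 mulmxBl [RHS]mxE.
    by rewrite [X in _ = _ + X]mxE.
  by rewrite dotQ // dnorm_ge0.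
by rewrite -(pmulr_lge0 _ u_gt0) z_ge0 -subr_ge0 -(pmulr_lge0 _ u_gt0) z_le1.
Qed.

(** The identity is absorbed by writing it as [Y *m Y^T *m invmx (Y *m Y^T)]. *)
Lemma M_CC_row_free (R : realType) (p q N : nat) (A : 'M[R]_(p, N))
    (Y : 'M[R]_(q, N)) : row_free Y ->
  M_CC A Y = Y *m (1%:M - mp_pinv A *m A) *m Y^T *m invmx (Y *m Y^T).
Proof.
move=> Yfree; rewrite /M_CC /A_f /A_b (penrose_row_free Yfree) mulmxBr mulmx1.
by rewrite !mulmxBl mulmxV ?row_free_gram // !mulmxA.
Qed.

Theorem mainTheorem2 (R : realType) (n m nH k N : nat)
    (Xs : set 'cV[R]_n) (Us : set 'cV[R]_m)
    (T : 'cV[R]_n -> 'cV[R]_m -> 'cV[R]_n)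
    (H : 'cV[R]_n -> 'cV[R]_nH) (G : 'cV[R]_m -> 'M[R]_(k, nH))
    (X Xp : 'M[R]_(n, N)) (U : 'M[R]_(m, N))
    (T_maps : forall x u, Xs x -> Us u -> Xs (T x u))
    (Psi_indep : components_independent Xs Us (normal_basis H G))
    (X_in : forall i : 'I_N, Xs (col i X))
    (U_in : forall i : 'I_N, Us (col i U))
    (Xp_eq : forall i : 'I_N, col i Xp = T (col i X) (col i U))
    (Psi_full : row_free (map_cols2 (normal_basis H G) X U))
    (H_full : row_free (map_cols H Xp)) :
  let M := M_CC (map_cols2 (normal_basis H G) X U) (map_cols H Xp) in
  (exists2 S : 'M[R]_nH, S^T = S & M ~_{in unitmx} S) /\
  (forall z : R[i], eigenvalue (map_mx (real_complex R) M) z ->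
     exists2 r : R, 0 <= r <= 1 & z = r%:C).
Proof.
move: (map_cols2 _ X U) (map_cols H Xp) H_full => A Y Yfree M.
pose Q : 'M[R]_N := 1%:M - mp_pinv A *m A.
have [Qsym Qidem] : Q^T = Q /\ Q *m Q = Q.
  have /and4P[_ /eqP BAB _ /eqP BA] := mp_pinvP A.
  split; first by rewrite linearB /= trmx1 BA.
  rewrite mulmxBl mul1mx mulmxBr mulmx1 mulmxA BAB.
  by rewrite subrr subr0.
have defM : M = Y *m Q *m Y^T *m invmx (Y *m Y^T) by exact: M_CC_row_free.
have Wunit := row_free_gram Yfree; split.
  have [P PW] := row_free_orthonormalize Yfree.
  have Punit : P \in unitmx by have [] := mulmx1_unit (etrans (mulmxA _ _ _) PW).
  exists (P *m Y *m Q *m (P *m Y)^T).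
    by rewrite !trmx_mul !trmxK Qsym !mulmxA.
  exists P => //; apply/similarRL => //; rewrite defM trmx_mul !mulmxA.
  (* This puts a factor [P] at the right end of [M], which cancels in [P *m M *m invmx P]. *)
  have PP : P^T *m P = invmx (Y *m Y^T).
    have PTPW : P^T *m P *m (Y *m Y^T) = 1%:M.
      by apply: mulmx1C; rewrite mulmxA; apply: mulmx1C; rewrite mulmxA.
    by rewrite -[LHS](mulmxK Wunit) PTPW mul1mx.
  by rewrite -PP !mulmxA mulmxK.
move=> z /eigenvalueP[v vM v_neq0].
pose c := real_complex R.
(* Nonzero because [Y] keeps its rank over the complex numbers. *)
pose u := v *m map_mx c Y.
have u_neq0 : u != 0.
  apply: contraNneq v_neq0 => u0; apply/eqP.
  have cYfree : row_free (map_mx c Y) by rewrite row_free_map.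
  by apply: (row_free_inj cYfree); rewrite mul0mx.
have conj_c p q (B : 'M[R]_(p, q)) : map_mx Num.conj (map_mx c B) = map_mx c B.
  by apply/matrixP => i j; rewrite !mxE; exact: conjc_real.
have MW : M *m (Y *m Y^T) = Y *m Q *m Y^T by rewrite defM mulmxKV.
(* Multiply [v *m M = z *: v] on the right by [Y *m Y^T], then by [v ^t*]. *)
have uQ : u *m map_mx c Q *m u ^t* = z *: (u *m u ^t*).
  have -> : u ^t* = map_mx c Y^T *m v ^t*.
    by rewrite trmx_mul map_mxM /= -map_trmx conj_c map_trmx.
  have -> : u *m map_mx c Q *m (map_mx c Y^T *m v ^t*)
            = v *m map_mx c (M *m (Y *m Y^T)) *m v ^t*.
    by rewrite MW !map_mxM /= !mulmxA.
  by rewrite map_mxM mulmxA vM -!scalemxAl map_mxM /= !mulmxA.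
have z01 : 0 <= z <= 1.
  apply: rayleigh_projector uQ => //.
    by rewrite map_trmx Qsym conj_c.
  by rewrite -map_mxM Qidem.
(* Nonnegative elements of [R[i]] have zero imaginary part. *)
have zreal : (complex.Re z)%:C = z.
  by apply: RRe_real; apply: ger0_real; case/andP: z01.
exists (complex.Re z) => //.
by rewrite -ler0c -(lecR _ 1) zreal.
Qed.
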